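(* Let $E$ be a finite set, $S=\mathbb{C}[x_e:e\in E]$, and let $I\subset S$ be a standard-homogeneous ideal not containing the irrelevant ideal. For $w\in\mathbb{R}^E$, let $I_w$ be the ideal of $S$ generated by the subspaces $\rho_\Delta(I)\subset\mathbb{C}[\Delta]\subset S$, over all cells $\Delta$ of $\operatorname{subd}_w\mathcal A(I)$. Then the set $$\Omega(I)=\{w\in\mathbb{R}^E: I_w=\operatorname{in}_wI\}$$ is the support of a subfan of the secondary fan $\operatorname{Sec}\mathcal A(I)$.
   Context: $\operatorname{in}_w p$ is the sum of the terms of $p$ of minimal $w$-weight (the weight of $\prod x_e^{\alpha_e}$ is $\sum w_e\alpha_e$), and $\operatorname{in}_wI$ is the ideal generated by all $\operatorname{in}_w p$, $p\in I$. $\mathcal L(I)=\{w:\operatorname{in}_wI=I\}$. $\mathcal A(I)=(a_e)_{e\in E}\subset\mathcal L(I)^*$, where $a_e$ is the restriction of the $e$-th coordinate functional to $\mathcal L(I)$. For a point configuration $A=(a_e)$ in $V$ and $w\in\mathbb{R}^E$, $\operatorname{subd}_wA$ is the set of cells $(a_e)_{e\in E_f}$, for $f\in V^*$, where $E_f$ is the set of $e$ minimizing $f(a_e)+w_e$. $\mathbb{C}[\Delta]=\mathbb{C}[x_e:a_e\in\Delta]$, and $\rho_\Delta:S\to\mathbb{C}[\Delta]$ kills the $x_e$ with $a_e\notin\Delta$. For a regular subdivision $\Theta$ of $A$, let $\operatorname{cone}(A,\Theta)$ be the closure of $\{w:\operatorname{subd}_wA=\Theta\}$. The secondary fan $\operatorname{Sec}A$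 is the complete polyhedral fan in $\mathbb{R}^E$ whose cones are the $\operatorname{cone}(A,\Theta)$. *)

(* Defs.v *)
From HB Require Import structures.
From mathcomp Require Import all_boot all_order all_algebra.
From mathcomp Require Export complex.
From mathcomp Require Export mpoly.
From mathcomp Require Export boolp classical_sets functions cardinality reals.
From mathcomp Require Export topology normedtype.

Set Implicit Arguments.
Unset Strict Implicit.
Unset Printing Implicit Defensive.

Import Order.TTheory GRing.Theory Num.Theory.
Import numFieldNormedType.Exports.

Local Open Scope ring_scope.
Local Open Scope classical_set_scope.

(* Ideals, as sets.  MathComp's [idealr] only covers proper, decidable ideals,
   whereas initial ideals are not known a priori to be proper. *)

Definition is_ideal (T : comNzRingType) (J : set T) : Prop :=
  [/\ J 0, forall p q, J p -> J q -> J (p + q)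
    & forall a p, J p -> J (a * p)].

Record ideal (T : comNzRingType) := Ideal {
  ideal_set :> set T;
  idealP : is_ideal ideal_set }.

Lemma smallest_is_ideal (T : comNzRingType) (G : set T) :
  is_ideal (smallest (@is_ideal T) G).
Proof.
split=> [J [[J0 _ _] _] //|p q Jp Jq J HJ|a p Jp J HJ].
  by case: (HJ) => -[_ JD _] _; apply: JD; [apply: Jp|apply: Jq].
by case: (HJ) => -[_ _ JM] _; apply: JM; apply: Jp.
Qed.

Definition ideal_gen (T : comNzRingType) (G : set T) : ideal T :=
  Ideal (smallest_is_ideal G).

Section Initial.
Variables (R : realType) (K : fieldType) (n : nat).
Implicit Types (w : 'rV[R]_n) (m : 'X_{1..n}) (p q : {mpoly K[n]}).
Implicit Types (I : ideal {mpoly K[n]}) (D : {set 'I_n}).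

Definition homogeneous_ideal I : Prop :=
  exists G : set {mpoly K[n]},
    (forall p, G p -> exists d : nat, p \is d.-homog) /\
    (I = ideal_gen G :> set {mpoly K[n]}).

Definition irrelevant_ideal : ideal {mpoly K[n]} :=
  ideal_gen (range (fun i : 'I_n => 'X_i : {mpoly K[n]})).

Definition weight w m : R := \sum_(i < n) w 0 i *+ m i.

Definition initial_form w p : {mpoly K[n]} :=
  \sum_(m <- msupp p | all (fun m' => weight w m <= weight w m') (msupp p))
    p@_m *: 'X_[m].

Definition initial_ideal w I : ideal {mpoly K[n]} :=
  ideal_gen (initial_form w @` I).

Definition lineality_set I : set 'rV[R]_n :=
  [set w | initial_ideal w I = I :> set {mpoly K[n]}].

(* C[D] is identified with the subring of S generated by the x_i, i \in D. *)
Definition rho D p : {mpoly K[n]} :=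
  p \mPo [tuple if i \in D then 'X_i else 0 | i < n].

(* [lineality_set I] is a linear subspace, because w belongs to it exactly when
   I is homogeneous for the grading by w-weight ([gradedP]). *)

Definition filt (P : pred 'X_{1..n}) p : {mpoly K[n]} :=
  \sum_(m <- msupp p | P m) p@_m *: 'X_[m].

Lemma mcoeff_filt (P : pred 'X_{1..n}) p m :
  (filt P p)@_m = if P m then p@_m else 0.
Proof.
rewrite /filt raddf_sum /= -big_filter.
have -> : \sum_(i <- [seq i <- msupp p | P i]) (p@_i *: 'X_[i])@_m
        = \sum_(i <- [seq i <- msupp p | P i]) (if i == m then p@_m else 0).
  apply: eq_bigr => i _; rewrite mcoeffZ mcoeffX.
  by case: eqP => [->|_]; rewrite ?mulr1 ?mulr0.
rewrite -big_mkcond /=.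
have [Hm|Hm] := boolP (m \in [seq i <- msupp p | P i]); last first.
  rewrite big1_seq; last first.
    by move=> i /andP[/eqP->]; rewrite (negbTE Hm).
  case: ifP => // Pm; move: Hm; rewrite mem_filter Pm /= => Hm.
  by rewrite (memN_msupp_eq0 Hm).
have Pm : P m by move: Hm; rewrite mem_filter => /andP[].
rewrite Pm -big_filter.
have -> : [seq i <- [seq i <- msupp p | P i] | i == m] = [:: m].
  by apply: filter_pred1_uniq => //; apply: filter_uniq; apply: msupp_uniq.
by rewrite big_seq1.
Qed.

Definition graded w I :=
  forall c p, ideal_set I p -> ideal_set I (filt (fun m => weight w m == c) p).

Lemma ideal_sum I (T : eqType) (s : seq T) (F : T -> {mpoly K[n]}) :
  (forall i, i \in s -> ideal_set I (F i)) -> ideal_set I (\sum_(i <- s) F i).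
Proof.
have [I0 ID _] := idealP I.
by move=> IF; rewrite big_seq; elim/big_ind: _ => // i /IF.
Qed.

Lemma weightD w m m' : weight w (m + m')%MM = weight w m + weight w m'.
Proof.
by rewrite -big_split /=; apply: eq_bigr => i _; rewrite mnmDE mulrnDr.
Qed.

Lemma weight_lin a w w' m : weight (a *: w + w') m = a * weight w m + weight w' m.
Proof.
rewrite mulr_sumr -big_split /=; apply: eq_bigr => i _.
by rewrite !mxE mulrnDl mulrnAr.
Qed.

Lemma filt_split w p (P : R -> pred 'X_{1..n}) :
  filt (fun m => P (weight w m) m) p
  = \sum_(c <- undup [seq weight w m | m <- msupp p])
      filt (fun m => weight w m == c) (filt (P c) p).
Proof.
apply/mpolyP => m; rewrite mcoeff_filt raddf_sum /=.
have [Hm|/memN_msupp_eq0 pm0] := boolP (m \in msupp p); last first.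
  by rewrite pm0 if_same big1 // => c _; rewrite !mcoeff_filt pm0 !if_same.
rewrite (bigD1_seq (weight w m)) ?undup_uniq ?mem_undup ?map_f //=.
rewrite !mcoeff_filt eqxx big1 ?addr0 // => c cm.
by rewrite mcoeff_filt eq_sym (negbTE cm).
Qed.

Lemma eq_filt (P Q : pred 'X_{1..n}) p :
  {in msupp p, P =1 Q} -> filt P p = filt Q p.
Proof.
move=> PQ; apply/mpolyP => m; rewrite !mcoeff_filt.
have [/PQ -> //|/memN_msupp_eq0 ->] := boolP (m \in msupp p).
by rewrite !if_same.
Qed.

Lemma filt_const b p : filt (fun=> b) p = if b then p else 0.
Proof.
by apply/mpolyP => m; rewrite mcoeff_filt; case: b; rewrite ?mcoeff0.
Qed.

Lemma graded_pred w I (Q : pred R) p :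
  graded w I -> ideal_set I p -> ideal_set I (filt (Q \o weight w) p).
Proof.
move=> gI Ip; rewrite (filt_split w p (fun c _ => Q c)).
apply: ideal_sum => c _; apply: gI; rewrite filt_const.
by case: ifP => // _; have [] := idealP I.
Qed.

Lemma graded_lin a w w' I : graded w I -> graded w' I -> graded (a *: w + w') I.
Proof.
move=> gw gw' c p Ip.
have -> : filt (fun m => weight (a *: w + w') m == c) p
  = filt (fun m => (fun c' m => a * weight w m + c' == c) (weight w' m) m) p.
  by apply: eq_filt => m _; rewrite weight_lin.
rewrite (filt_split w' p (fun c' m => a * weight w m + c' == c)).
apply: ideal_sum => c' _; apply: gw'.
exact: (@graded_pred w I (fun d => a * d + c' == c)).
Qed.

Lemma graded0 I : graded 0 I.
Proof.
move=> c p Ip.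
have -> : filt (fun m => weight 0 m == c) p = filt (fun=> 0 == c) p.
  apply: eq_filt => m _; congr (_ == c).
  by rewrite /weight big1 // => i _; rewrite mxE mul0rn.
by rewrite filt_const; case: ifP => // _; have [] := idealP I.
Qed.

Lemma initial_form_filt w p :
  initial_form w p = 0 \/
  exists c, initial_form w p = filt (fun m => weight w m == c) p.
Proof.
pose P m := all (fun m' => weight w m <= weight w m') (msupp p).
have [/hasP[m0 m0p Pm0]|/hasPn noP] := boolP (has P (msupp p)).
  right; exists (weight w m0); apply: (@eq_filt P) => m mp; apply/idP/eqP.
    move=> /allP Pm; apply/eqP; rewrite eq_le Pm //=.
    by move/allP: Pm0; apply.
  by rewrite /P => ->.
left; rewrite /initial_form big1_seq // => m /andP[Pm /noP].
by rewrite /P Pm.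
Qed.

Lemma initial_form_homog w c p :
  initial_form w (filt (fun m => weight w m == c) p)
  = filt (fun m => weight w m == c) p.
Proof.
set q := filt _ p.
have wq m : m \in msupp q -> weight w m = c.
  by rewrite mcoeff_msupp mcoeff_filt; case: ifP => [/eqP//|_]; rewrite eqxx.
rewrite -[RHS](filt_const true); apply: eq_filt => m mq.
by apply/allP => m' m'q; rewrite !wq.
Qed.

Lemma filtMX (P : pred 'X_{1..n}) m p :
  filt P ('X_[m] * p) = 'X_[m] * filt (fun m' => P (m + m')%MM) p.
Proof.
apply/mpolyP => k; rewrite mcoeff_filt !mcoeffM.
transitivity (\sum_(j : 'X_{1..n < (mdeg k).+1, (mdeg k).+1}
    | k == (j.1 + j.2)%MM)
    if P k then ('X_[m] : {mpoly K[n]})@_j.1 * p@_j.2 else 0).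
  by case: ifP => // _; rewrite big1.
apply: eq_bigr => j /eqP kj; rewrite mcoeff_filt mcoeffX.
have -> : P k = P (j.1 + j.2)%MM by rewrite -kj.
by case: eqP => [->|_]; case: ifP; rewrite ?(mul0r, mulr0) ?if_same.
Qed.

Lemma filtD (P : pred 'X_{1..n}) p q : filt P (p + q) = filt P p + filt P q.
Proof.
apply/mpolyP => m; rewrite !(mcoeffD, mcoeff_filt).
by case: ifP; rewrite ?addr0.
Qed.

Lemma filtZ (P : pred 'X_{1..n}) a p : filt P (a *: p) = a *: filt P p.
Proof.
apply/mpolyP => m; rewrite !(mcoeffZ, mcoeff_filt).
by case: ifP; rewrite ?mulr0.
Qed.

Lemma initial_in w I p :
  ideal_set I p -> ideal_set (initial_ideal w I) (initial_form w p).
Proof. by move=> Ip J [_]; apply; exists p. Qed.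

Lemma gradedP w I : lineality_set I w <-> graded w I.
Proof.
have [I0 ID IM] := idealP I.
split=> [Iw c p|gI].
  pose J := [set p | forall c, ideal_set I (filt (fun m => weight w m == c) p)].
  suff IJ : ideal_set I `<=` J by move/IJ; apply.
  rewrite -{1}Iw; apply: smallest_sub.
    split=> [d|q r Jq Jr d|a q Jq d].
    - have -> // : filt (fun m => weight w m == d) 0 = 0.
      by rewrite /filt msupp0 big_nil.
    - by rewrite filtD; apply: ID.
    rewrite (mpolyE a) mulr_suml.
    elim/big_rec: _ => [|m r _ Ir].
      have -> // : filt (fun m => weight w m == d) 0 = 0.
      by rewrite /filt msupp0 big_nil.
    rewrite filtD; apply: ID => //.
    rewrite -scalerAl filtZ filtMX -mul_mpolyC; apply: (IM); apply: (IM).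
    have -> : filt (fun m' => weight w (m + m')%MM == d) q
            = filt (fun m' => weight w m' == d - weight w m) q.
      by apply: eq_filt => m' _; rewrite weightD addrC -subr_eq opprK.
    exact: Jq.
  move=> _ [q Iq <-] d.
  have Iq' : ideal_set I (initial_form w q) by rewrite -Iw; apply: initial_in.
  case: (initial_form_filt w q) Iq' => [->|[e ->]] Iq'.
    by rewrite /filt msupp0 big_nil.
  have -> : filt (fun m => weight w m == d) (filt (fun m => weight w m == e) q)
          = if d == e then filt (fun m => weight w m == e) q else 0.
    apply/mpolyP => m; rewrite !mcoeff_filt.
    have [<-|de] := eqVneq d e.
      by rewrite mcoeff_filt; case: ifP => // ->.
    by rewrite mcoeff0; case: eqP => // ->; rewrite (negbTE de).
  by case: ifP.
apply/seteqP; split.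
  apply: smallest_sub; first exact: idealP.
  move=> _ [q Iq <-].
  by case: (initial_form_filt w q) => [->//|[e ->]]; apply: gI.
move=> p Ip.
rewrite -[p](filt_const true) (filt_split w p (fun _ _ => true)) filt_const.
apply: ideal_sum => c _; rewrite -initial_form_homog.
by apply: initial_in; apply: gI.
Qed.

Lemma lineality_subspace I :
  exists U : {vspace 'rV[R]_n}, forall w, w \in U <-> lineality_set I w.
Proof.
pose P d := `[< exists U : {vspace 'rV[R]_n},
  (forall w, w \in U -> lineality_set I w) /\ \dim U = d >].
have exP : exists d, P d.
  exists 0%N; apply/asboolP; exists 0%VS; rewrite dimv0; split=> // w.
  by rewrite memv0 => /eqP ->; apply/gradedP/graded0.
have leP d : P d -> (d <= \dim (fullv : {vspace 'rV[R]_n}))%N.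
  by case/asboolP => U [_ <-]; apply: dimvS; apply: subvf.
case: (ex_maxnP exP leP) => d /asboolP[U [UI dU]] maxd.
exists U => w; split=> [|Iw]; first exact: UI.
suff /subvP/(_ w) : (U + <[w]> <= U)%VS.
  by apply; apply: (subvP (addvSr U _)); apply: memv_line.
have UwI v : v \in (U + <[w]>)%VS -> lineality_set I v.
  case/memv_addP => u uU [_ /vlineP[a ->] ->].
  rewrite addrC; apply/gradedP/graded_lin; apply/gradedP => //.
  exact: UI.
rewrite -(geq_leqif (dimv_leqif_sup (addvSl U <[w]>%VS))) dU.
by apply: maxd; apply/asboolP; exists (U + <[w]>)%VS.
Qed.

Definition lineality I : {vspace 'rV[R]_n} := sval (cid (lineality_subspace I)).

Lemma linealityP I w : w \in lineality I <-> lineality_set I w.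
Proof. exact: (svalP (cid (lineality_subspace I))). Qed.

Lemma coordinate_linear I (i : 'I_n) :
  linear (fun u : subvs_of (lineality I) => vsval u 0 i : R^o).
Proof. by move=> a u v; rewrite linearP !mxE. Qed.

Definition config_of I (i : 'I_n) : 'Hom(subvs_of (lineality I), R^o) :=
  linfun (fun u : subvs_of (lineality I) => vsval u 0 i : R^o).

Lemma config_ofE I i u : config_of I i u = vsval u 0 i.
Proof.
pose f := GRing.isLinear.Build R (subvs_of (lineality I)) R^o *:%R
  (fun u => vsval u 0 i : R^o) (coordinate_linear i).
pose F : {linear _ -> _} :=
  HB.pack (fun u : subvs_of (lineality I) => vsval u 0 i : R^o) f.
exact: (lfunE F).
Qed.

End Initial.

Section Subdivision.
Variables (R : realType) (n : nat) (V : vectType R).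
Implicit Types (A : 'I_n -> V) (w : 'rV[R]_n).

(* A cell is a subfamily of A, hence is represented by its set of labels;
   distinct labels may carry the same point. *)
Definition min_face A w (f : 'Hom(V, R^o)) : {set 'I_n} :=
  [set i | [forall j, f (A i) + w 0 i <= f (A j) + w 0 j]].

Definition subd A w : set {set 'I_n} := range (min_face A w).

Definition regular_subdivision A (Theta : set {set 'I_n}) : Prop :=
  exists w, subd A w = Theta.

Definition secondary_cone A (Theta : set {set 'I_n}) : set 'rV[R]_n :=
  closure [set w : 'rV[R]_n | subd A w = Theta].

Definition secondary_fan A : set (set 'rV[R]_n) :=
  [set secondary_cone A Theta | Theta in regular_subdivision A].

End Subdivision.

Section Fan.
Variables (R : realType) (n : nat).
Implicit Types (C D : set 'rV[R]_n) (F G : set (set 'rV[R]_n)).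

Definition polyhedral_cone C : Prop :=
  exists (m : nat) (M : 'M[R]_(n, m)),
    C = [set x | forall j, 0 <= (x *m M) 0 j].

Definition face C D : Prop :=
  exists l : 'cV[R]_n, (forall x, C x -> 0 <= (x *m l) 0 0) /\
    D = C `&` [set x | (x *m l) 0 0 = 0].

Definition is_fan F : Prop :=
  [/\ finite_set F,
      forall C, F C -> polyhedral_cone C,
      forall C D, F C -> face C D -> F D
    & forall C D, F C -> F D -> face C (C `&` D) /\ face D (C `&` D)].

Definition subfan F G : Prop := G `<=` F /\ is_fan G.

Definition fan_support F : set 'rV[R]_n := \bigcup_(C in F) C.

End Fan.

Section Omega.
Variables (R : realType) (K : fieldType) (n : nat).
Variable I : ideal {mpoly K[n]}.

Definition cellular_ideal (w : 'rV[R]_n) : ideal {mpoly K[n]} :=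
  ideal_gen (\bigcup_(D in subd (config_of R I) w) (rho D @` I)).

Definition Omega : set 'rV[R]_n :=
  [set w | cellular_ideal w = initial_ideal w I :> set {mpoly K[n]}].

End Omega.

(* Main.v *)
(* All the ideals [I_w] and [in_w I] are homogeneous for the grading of [I] by
   its lineality space [L], and the cells of [subd_w] are the zero sets of the
   nonnegative vectors of [w + L].  For such a vector [x] with zero set [D], the
   restriction of [p] to [D] is the part of [p] of [x]-weight 0, whence
   [I_w <= in_w I]; and if [subd_w] refines [subd_w'], then
   [I_w <= in_w (I_w')].  Passing to an initial ideal preserves Hilbert
   functions, so if moreover [I_w = in_w I], then
   [h I = h I_w <= h I_w' <= h (in_w' I) = h I], which forces
   [I_w' = in_w' I].  Thus [Omega I] is closed under coarsening of subdivisions.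

   The closed secondary cone of [w] is the set of all [w'] such that [subd_w]
   refines [subd_w'].  It is polyhedral by Fourier-Motzkin elimination, and the
   remaining fan axioms follow from one fact: if [subd_w] refines [subd_w1] and
   [subd_w2], then [subd_(w1 + w2)] refines [subd_w1]. *)
From HB Require Import structures.
Require Import Defs.
From mathcomp Require Import all_boot all_order all_algebra.
From mathcomp Require Import complex mpoly boolp classical_sets reals.
From mathcomp Require Import cardinality topology normedtype.
From mathcomp Require Import ring lra.

Set Implicit Arguments.
Unset Strict Implicit.
Unset Printing Implicit Defensive.

Import Order.TTheory GRing.Theory Num.Theory.
Import numFieldNormedType.Exports.

Local Open Scope ring_scope.
Local Open Scope classical_set_scope.

(** * Polyhedral cones *)

Section Polyhedral.
Variables (R : realType) (V : lmodType R).
Implicit Types (C : set V).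

(** Functionals instead of a matrix: the notion is also needed on the product space in
    [sum_minimizer]. *)
Definition polyhedral C : Prop :=
  exists (J : finType) (F : J -> V -> R),
    (forall j, scalar (F j)) /\ C = [set x | forall j, 0 <= F j x].

Lemma scalar0 (f : V -> R) : scalar f -> f 0 = 0.
Proof. by move=> /(_ (-1) 0 0); rewrite scaler0 addr0 mulN1r addNr. Qed.

Lemma scalarDZ (f : V -> R) x t v : scalar f -> f (x + t *: v) = f x + t * f v.
Proof. by move=> fl; rewrite addrC fl addrC. Qed.

Lemma eps_small (J : finType) (a b : J -> R) :
  (forall j, 0 <= a j) -> (forall j, a j = 0 -> 0 <= b j) ->
  exists2 e, 0 < e & forall j,
    0 <= a j + e * b j /\ (0 < a j -> 0 < a j + e * b j).
Proof.
move=> a0 ab.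
(* Division by 0 gives 0, so indices with [a j = 0] contribute nothing, and |b j| < s a j whenever
   [a j > 0]. *)
pose s := 1 + \sum_j `|b j| / a j.
have t0 j : 0 <= `|b j| / a j by rewrite divr_ge0.
have s0 : 0 < s by rewrite ltr_wpDr // sumr_ge0.
have pos j : 0 < a j -> 0 < a j + s^-1 * b j.
  move=> aj; have ts : `|b j| / a j < s.
    rewrite /s (bigD1 j) //= addrCA ltrDl ltr_wpDr //.
    by apply: sumr_ge0.
  rewrite addrC -ltrBlDr sub0r; apply: ltrNnormlW.
  rewrite normrM gtr0_norm ?invr_gt0 // ltr_pdivrMl //.
  by rewrite -ltr_pdivrMr.
exists s^-1; first by rewrite invr_gt0.
move=> j; split; last exact: pos.
have [aj|] := ltP 0 (a j); first exact/ltW/pos.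
rewrite le_eqVlt ltNge a0 orbF => /eqP aj.
by rewrite aj add0r mulr_ge0 ?ab // invr_ge0 ltW.
Qed.

Lemma between (J : finType) (P Q : pred J) (a : J -> R) :
  (forall i j, P i -> Q j -> a i <= a j) ->
  exists t, (forall i, P i -> a i <= t) /\ (forall j, Q j -> t <= a j).
Proof.
move=> PQ; have [[i0 Pi0]|noP] := pselect (exists i, P i).
  case: (arg_maxP a Pi0) => i Pi maxi; exists (a i); split=> [k /maxi//|j Qj].
  exact: PQ.
have [[j0 Qj0]|noQ] := pselect (exists j, Q j).
  case: (arg_minP a Qj0) => j Qj minj; exists (a j); split=> [k Pk|k /minj//].
  by case: noP; exists k.
by exists 0; split=> k ?; [case: noP|case: noQ]; exists k.
Qed.

Lemma fourier_motzkin C v :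
  polyhedral C -> polyhedral [set x | exists t, C (x + t *: v)].
Proof.
move=> [J [F [Fl ->]]].
(* [inl] keeps the inequalities free of [t]; [inr] compares a lower with an upper bound on [t],
   denominators cleared. The other indices give the trivial inequality. *)
pose G (k : J + J * J) x := match k with
  | inl j => if F j v == 0 then F j x else 0
  | inr (i, j) => if (0 < F i v) && (F j v < 0)
                  then F i v * F j x - F j v * F i x else 0 end.
exists (J + J * J)%type, G; split.
  move=> [j|[i j]] a x y /=; case: ifP => _; rewrite ?mulr0 ?addr0 ?Fl //; ring.
apply/seteqP; split=> x /=.
  move=> [t Ct] [j|[i j]] /=; case: ifP => //.
    by move=> /eqP Fv; have := Ct j; rewrite scalarDZ // Fv mulr0 addr0.
  move=> /andP[Fi Fj].
  have := Ct i; have := Ct j; rewrite !scalarDZ // => Cj Ci.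
  have := mulr_ge0 (ltW Fi) Cj.
  have := mulr_ge0_le0 Ci (ltW Fj); nra.
move=> Gx.
have [i j|t [lt gt]] := @between J (fun i => 0 < F i v) (fun j => F j v < 0)
    (fun j => - F j x / F j v).
  move=> Fi Fj; have := Gx (inr (i, j)); rewrite /= Fi Fj /=.
  rewrite ler_pdivrMr // mulrAC ler_ndivlMr //; lra.
exists t => j; rewrite scalarDZ //.
have [Fj|Fj|Fj] := ltgtP (F j v) 0.
- by have := gt j Fj; rewrite ler_ndivlMr //; lra.
- by have := lt j Fj; rewrite ler_pdivrMr //; lra.
- by have := Gx (inl j); rewrite /= Fj eqxx mulr0 addr0.
Qed.

(** Induction on a spanning list of [L], with one elimination per vector. The map [g] lets [L] act
    on a larger space. *)
Lemma polyhedral_projection (W : vectType R) (L : {vspace W}) (g : W -> V) C :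
  linear g -> polyhedral C -> polyhedral [set x | exists2 l, l \in L & C (x + g l)].
Proof.
move=> gl pC.
suff H (s : seq W) : polyhedral [set x | exists2 l, l \in <<s>>%VS & C (x + g l)].
  by have := H (vbasis L); rewrite (span_basis (vbasisP L)).
elim: s => [|v s IH].
  suff -> : [set x | exists2 l, l \in <<[::]>>%VS & C (x + g l)] = C by [].
  have g0 : g 0 = 0 by have := gl (-1) 0 0; rewrite scaler0 addr0 scaleN1r addNr.
  apply/seteqP; split=> x /=.
    by move=> [l]; rewrite span_nil memv0 => /eqP ->; rewrite g0 addr0.
  by exists 0; rewrite ?mem0v // g0 addr0.
suff -> : [set x | exists2 l, l \in <<v :: s>>%VS & C (x + g l)]
   = [set x | exists t, [set x | exists2 l, l \in <<s>>%VS & C (x + g l)] (x + t *: g v)].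
  exact: fourier_motzkin.
apply/seteqP; split=> x /=.
  move=> [l0]; rewrite span_cons => /memv_addP[_ /vlineP[t ->] [l ls ->]].
  by rewrite gl addrA => Cx; exists t, l.
move=> [t [l ls]]; rewrite -addrA -gl => Cx; exists (t *: v + l) => //.
rewrite span_cons; apply: memv_add => //; apply: memvZ; exact: memv_line.
Qed.

Lemma polyhedral_if (P : Prop) C : polyhedral C -> polyhedral [set x | P -> C x].
Proof.
have [p|np] := pselect P.
  by have -> : [set x | P -> C x] = C by apply/seteqP; split=> x //=; apply.
move=> _; exists void, (fun _ _ => 0); split=> [[]|].
by apply/seteqP; split=> x //= _ [].
Qed.

Lemma polyhedral_bigcap (K : finType) (C : K -> set V) :
  (forall k, polyhedral (C k)) -> polyhedral [set x | forall k, C k x].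
Proof.
move=> /choice[J] /(_ _)/cid FP.
have CE k x : C k x <-> forall j, 0 <= sval (FP k) j x.
  by case: (FP k) => F [_ CF] /=; rewrite CF.
exists {k : K & J k}, (fun p => sval (FP (tag p)) (tagged p)); split.
  by move=> [k j] /=; case: (FP k) => F [].
apply/seteqP; split=> x /= xC; first by move=> [k j] /=; apply: (CE k x).1.
by move=> k; apply/CE => j; exact: (xC (Tagged J (j : J k))).
Qed.

End Polyhedral.

(** * Refinement of regular subdivisions *)

Section Refinement.
Variables (R : realType) (n : nat) (L : {vspace 'rV[R]_n}).
Implicit Types (w x y l : 'rV[R]_n) (D : {set 'I_n}).

Definition nonneg x : Prop := forall i, 0 <= x 0 i.

Definition zeros x : {set 'I_n} := [set i | x 0 i == 0].

Lemma zerosP x i : reflect (x 0 i = 0) (i \in zeros x).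
Proof. by rewrite inE; apply: eqP. Qed.

(* When [L] contains the constant vectors, these are the cells of the regular
   subdivision induced by [w], and the empty set. *)
Definition cell w D : Prop := exists x, [/\ nonneg x, x - w \in L & zeros x = D].

(** Vectors rather than subdivisions, so that the [w'] refined by [w] visibly form a convex cone. *)
Definition refines w w' : Prop := forall x, nonneg x -> x - w \in L ->
  exists y, [/\ nonneg y, y - w' \in L & zeros x \subset zeros y].

Lemma nonnegD x y : nonneg x -> nonneg y -> nonneg (x + y).
Proof. by move=> x0 y0 i; rewrite mxE addr_ge0. Qed.

Lemma eps_nonneg x y : nonneg x -> (forall i, i \in zeros x -> 0 <= y 0 i) ->
  exists2 e, 0 < e & nonneg (x + e *: y) /\
    forall i, x 0 i != 0 -> (x + e *: y) 0 i != 0.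
Proof.
move=> x0 xy.
have [i xi|e e0 He] := @eps_small R 'I_n (fun i => x 0 i) (fun i => y 0 i) x0.
  by apply: xy; apply/zerosP.
exists e => //; split=> i; rewrite !mxE; first by case: (He i).
by move=> xi; rewrite gt_eqF //; apply: (He i).2; rewrite lt_neqAle eq_sym xi x0.
Qed.

Lemma refines_refl w : refines w w.
Proof. by move=> x x0 xw; exists x. Qed.

Lemma refines_trans w1 w2 w3 : refines w1 w2 -> refines w2 w3 -> refines w1 w3.
Proof.
move=> r12 r23 x x0 xw; have [y [y0 yw xy]] := r12 x x0 xw.
have [z [z0 zw yz]] := r23 y y0 yw.
by exists z; split=> //; apply: fintype.subset_trans xy yz.
Qed.

Lemma refinesD w w1 w2 : refines w w1 -> refines w w2 -> refines w (w1 + w2).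
Proof.
move=> r1 r2 x x0 xw; have [y1 [y10 yw1 xy1]] := r1 x x0 xw.
have [y2 [y20 yw2 xy2]] := r2 x x0 xw.
exists (y1 + y2); split; first exact: nonnegD.
  by rewrite opprD addrACA memvD.
apply/fintype.subsetP => i ix; apply/zerosP; rewrite mxE.
by rewrite (zerosP _ _ (fintype.subsetP xy1 _ ix)) (zerosP _ _ (fintype.subsetP xy2 _ ix)) addr0.
Qed.

Lemma refinesZ a w w' : 0 <= a -> refines w w' -> refines w (a *: w').
Proof.
move=> a0 r x x0 xw; have [y [y0 yw xy]] := r x x0 xw.
exists (a *: y); split.
- by move=> i; rewrite mxE mulr_ge0.
- by rewrite -scalerBr memvZ.
apply/fintype.subsetP => i /(fintype.subsetP xy) /zerosP yi.
by apply/zerosP; rewrite mxE yi mulr0.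
Qed.

Lemma refines0 w : refines w 0.
Proof. by have := refinesZ (lexx 0) (@refines_refl w); rewrite scale0r. Qed.

(** The zeros of [x] lie among those of [y], and these among those of [z], with [x] and [z] in
    [w + L]. On the zeros of [y] the vector x - z of [L] equals [x], so moving [y] slightly along it
    leaves exactly the zeros of [x]. *)
Lemma refines_cell w w' D : refines w w' -> refines w' w -> cell w D -> cell w' D.
Proof.
move=> r r' [x [x0 xw <-]]; have [y [y0 yw xy]] := r x x0 xw.
have [z [z0 zw yz]] := r' y y0 yw.
have [i iy|e e0 [He0 Hez]] := @eps_nonneg y (x - z) y0.
  by rewrite !mxE (zerosP _ _ (fintype.subsetP yz _ iy)) subr0.
exists (y + e *: (x - z)); split=> //.
  rewrite addrAC memvD // memvZ //.
  by rewrite -(subrKA w) memvD // -[w - z]opprB memvN.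
apply/setP => i; apply/zerosP/zerosP => [|xi].
  have [/zerosP yi|yi] := boolP (i \in zeros y); last first.
    by move=> h; have := Hez i; rewrite h eqxx; case: eqP yi => [/zerosP->|_ _ /(_ isT)].
  have zi : z 0 i = 0 by apply/zerosP/(fintype.subsetP yz)/zerosP.
  rewrite !mxE yi add0r zi subr0.
  by move/eqP; rewrite mulf_eq0 gt_eqF //= => /eqP.
have yi : i \in zeros y by apply: (fintype.subsetP xy); apply/zerosP.
rewrite !mxE (zerosP _ _ yi) xi (zerosP _ _ (fintype.subsetP yz _ yi)).
by rewrite subr0 mulr0 addr0.
Qed.

Lemma cell_refines w w' : (forall D, cell w D -> cell w' D) -> refines w w'.
Proof.
move=> cc x x0 xw; case: (cc (zeros x)) => [|y [y0 yw yx]]; first by exists x.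
by exists y; rewrite yx.
Qed.

(** Leaves finitely many conditions, one per set of labels, as polyhedrality and a uniform choice of
    epsilon demand. *)
Lemma refines_cellP w w' : refines w w' <->
  forall D, cell w D -> exists y, [/\ nonneg y, y - w' \in L & D \subset zeros y].
Proof.
split=> [r _ [x [x0 xw <-]]|H x x0 xw]; first exact: r.
by apply: H; exists x.
Qed.

(** For a fixed cell [D] the condition is that [x + L] meets the cone [C D], which defines a
    projection of that cone. *)
Lemma polyhedral_refines w : polyhedral [set x | refines w x].
Proof.
pose C D := [set y | nonneg y /\ D \subset zeros y].
have pC D : polyhedral (C D).
  pose F (k : 'I_n + 'I_n) y : R := match k with
    | inl i => y 0 i | inr i => if i \in D then - y 0 i else 0 end.
  exists ('I_n + 'I_n)%type, F; split.
    move=> [i|i] a x y /=; rewrite ?mxE //; case: ifP => _; ring.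
  apply/seteqP; split=> y /=.
    move=> [y0 Dy] [i|i] //=; case: ifP => // /(fintype.subsetP Dy)/zerosP ->.
    by rewrite oppr0.
  move=> Fy; split=> [i|]; first exact: (Fy (inl i)).
  apply/fintype.subsetP => i iD; apply/zerosP/eqP; rewrite eq_le (Fy (inl i)) andbT.
  by have := Fy (inr i); rewrite /= iD oppr_ge0.
have -> : [set x | refines w x] =
    [set x | forall D, cell w D -> exists2 l, l \in L & C D (x + l)].
  apply/seteqP; split=> x /=; rewrite refines_cellP => H D cD.
    by have [y [y0 yx Dy]] := H D cD; exists (y - x); rewrite // addrC subrK.
  have [l lL [y0 Dy]] := H D cD; exists (x + l).
  by rewrite addrAC subrr add0r.
apply: polyhedral_bigcap => D; apply: polyhedral_if.
exact: (@polyhedral_projection R _ _ L id).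
Qed.

(** The vector [w] is relatively interior to its own cone, so a small multiple of any member can be
    subtracted from it. *)
Lemma refines_extend w x : refines w x ->
  exists2 e, 0 < e & refines w (w - e *: x).
Proof.
move=> /refines_cellP rx.
have /choice[y yP] D : exists y, cell w D -> [/\ nonneg y, y - w \in L & zeros y = D].
  by have [[y yD]|] := pselect (cell w D); [exists y|exists 0].
have /choice[u uP] D : exists u, cell w D ->
    [/\ nonneg u, u - x \in L & D \subset zeros u].
  have [/rx[u uD]|] := pselect (cell w D); first by exists u.
  by exists 0.
(* Indexed by a set and a label, with 0 where the set is not a cell, so that one [e] serves all
   cells. *)
pose a (p : {set 'I_n} * 'I_n) := if `[< cell w p.1 >] then y p.1 0 p.2 else 0.
pose b (p : {set 'I_n} * 'I_n) := if `[< cell w p.1 >] then - u p.1 0 p.2 else 0.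
have [[D i]|[D i]|e e0 He] := @eps_small R _ a b.
- by rewrite /a /=; case: asboolP => // /yP[y0 _ _].
- rewrite /a /b /=; case: asboolP => // cD yi; have [_ _ yD] := yP D cD.
  have [_ _ /fintype.subsetP/(_ i) uD] := uP D cD.
  by rewrite (zerosP _ _ (uD _)) ?oppr0 // -yD; apply/zerosP.
exists e => //; apply/refines_cellP => D cD.
have [y0 yw yD] := yP D cD; have [u0 ux uD] := uP D cD.
exists (y D - e *: u D); split.
- move=> i; have [] := He (D, i); rewrite /a /b /= (asboolT cD) => + _.
  by rewrite !mxE mulrN.
- by rewrite opprD addrACA -opprD -scalerBr memvB // memvZ.
apply/fintype.subsetP => i iD; apply/zerosP; rewrite !mxE.
by rewrite (zerosP _ _ (fintype.subsetP uD _ iD)) mulr0 subr0; apply/zerosP; rewrite yD.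
Qed.

Hypothesis L1 : const_mx 1 \in L.

Lemma nonneg_shift w : exists2 x, nonneg x & x - w \in L.
Proof.
exists (w + (\sum_i `|w 0 i|) *: const_mx 1); last first.
  by rewrite addrAC subrr add0r memvZ.
move=> i; rewrite !mxE mulr1 (bigD1 i) //= addrA addr_ge0 ?sumr_ge0 //.
by have := lerNnormlW (lexx `|w 0 i|); lra.
Qed.

(** The minimum is attained because the set [S] of numbers bounding some feasible sum from above is
    cut out by finitely many weak linear inequalities. *)
Lemma sum_minimizer w D : exists x, [/\ nonneg x, x - w \in L &
  forall y, nonneg y -> y - w \in L -> \sum_(i in D) x 0 i <= \sum_(i in D) y 0 i].
Proof.
pose V := ('rV[R]_n * R^o)%type.
(* The epigraph of the objective; its projection along [L] has [S] as slice over [w]. *)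
pose C : set V := [set p | nonneg p.1 /\ \sum_(i in D) p.1 0 i <= p.2].
have pC : polyhedral C.
  pose F (k : option 'I_n) (p : V) : R := match k with
    | Some i => p.1 0 i | None => p.2 - \sum_(i in D) p.1 0 i end.
  exists (option 'I_n), F; split.
    move=> [i|] a p q /=; rewrite ?mxE //.
    rewrite mulrBr mulr_sumr -addrACA -opprD -big_split /=.
    by congr (_ - _); apply: eq_bigr => i _; rewrite !mxE.
  apply/seteqP; split=> p /=.
    by move=> [p0 ps] [i|] /=; rewrite ?subr_ge0.
  move=> Fp; split=> [i|]; first exact: (Fp (Some i)).
  by have := Fp None; rewrite /= subr_ge0.
have gl : linear (fun l : 'rV[R]_n => (l, 0) : V).
  by move=> a x y; congr (_, _); rewrite /= scaler0 addr0.
have [J [F [Fl QE]]] := polyhedral_projection L gl pC.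
pose S : set R := [set s | forall j, 0 <= F j (w, s)].
have SP s : S s <-> exists x, [/\ nonneg x, x - w \in L & \sum_(i in D) x 0 i <= s].
  have -> : S s <-> [set x | forall j, 0 <= F j x] (w, s) by [].
  rewrite -QE /=; split=> [[l lL [/= x0 xs]]|[x [x0 xw xs]]].
    exists (w + l); split=> //; first by rewrite addrAC subrr add0r.
    by rewrite addr0 in xs.
  exists (x - w) => //; split; rewrite /= addrC subrK //.
  by rewrite addr0.
have S0 : S !=set0.
  have [x x0 xw] := nonneg_shift w.
  by exists (\sum_(i in D) x 0 i); apply/SP; exists x.
have Sl : has_lbound S.
  by exists 0 => s /SP[x [x0 _]]; apply: le_trans; apply: sumr_ge0.
have : S (inf S).
  move=> j; rewrite leNgt; apply/negP => Fj.
  (* Each inequality is affine in [s]. If it failed at the infimum, it would fail on all of [S] when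
     its slope is at most 0, and at points of [S] near the infimum otherwise. *)
  have FE s : F j (w, s) = F j (w, inf S) + (s - inf S) * F j (0, 1).
    rewrite -scalarDZ //; congr (F j (_, _)); rewrite /= ?scaler0 ?addr0 //.
    by rewrite [_ *: _]mulr1 addrC subrK.
  have [s0 Ss0] := S0; have [F1|F1] := ltP 0 (F j (0, 1)); last first.
    have := Ss0 j; rewrite FE leNgt => /negP; apply.
    rewrite ltr_wnDr // mulr_ge0_le0 // subr_ge0; exact: ge_inf.
  have e0 : 0 < - F j (w, inf S) / F j (0, 1) by rewrite divr_gt0 // oppr_gt0.
  have [s Ss sl] := inf_adherent e0 (conj S0 Sl).
  move: sl; rewrite -ltrBlDl ltr_pdivlMr // => sl.
  by have := Ss j; rewrite FE; lra.
move=> /SP[x [x0 xw xs]]; exists x; split=> // y y0 yw.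
by apply: le_trans xs _; apply: ge_inf => //; apply/SP; exists y.
Qed.

(* LP duality in disguise: the sum of the coordinate functionals over [D] lies
   in the cone spanned by those of some cell. *)
Lemma covering_cell w D : exists x, [/\ nonneg x, x - w \in L &
  forall l, l \in L -> (forall i, i \in zeros x -> 0 <= l 0 i) ->
    0 <= \sum_(i in D) l 0 i].
Proof.
have [x [x0 xw xmin]] := sum_minimizer w D; exists x; split=> // l lL lx.
(* As [l] is nonnegative where [x] vanishes, [x + e *: l] is still feasible, and its sum cannot be
   smaller. *)
have [e e0 [xe _]] := eps_nonneg x0 lx.
have := xmin _ xe; rewrite addrAC memvD ?memvZ // => /(_ isT).
under [leRHS]eq_bigr do rewrite !mxE.
by rewrite big_split /= -mulr_sumr lerDl pmulr_rge0.
Qed.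

(** Take the cell of [w] that [covering_cell] yields for the zeros of [x]. Both [y1] and [y2] vanish
    on it, so the vector x - y1 - y2 of [L] is nonnegative there, and hence has nonnegative sum over
    the zeros of [x]. But there it equals -(y1 + y2), which forces [y1] to vanish. *)
Lemma refines_addl w w1 w2 :
  refines w w1 -> refines w w2 -> refines (w1 + w2) w1.
Proof.
move=> r1 r2 x x0 xw; have [z [z0 zw zD]] := covering_cell w (zeros x).
have [y1 [y10 yw1 zy1]] := r1 z z0 zw.
have [y2 [y20 yw2 zy2]] := r2 z z0 zw.
exists y1; split=> //.
have lL : x - y1 - y2 \in L.
  have -> : x - y1 - y2 = (x - (w1 + w2)) - (y1 - w1) - (y2 - w2).
    by apply/rowP => i; rewrite !mxE; ring.
  by do 2 apply: memvB => //.
have := zD _ lL.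
have -> : \sum_(i in zeros x) (x - y1 - y2) 0 i
   = - \sum_(i in zeros x) (y1 0 i + y2 0 i).
  rewrite -sumrN; apply: eq_bigr => i /zerosP xi; rewrite !mxE xi; ring.
have lz i : i \in zeros z -> 0 <= (x - y1 - y2) 0 i.
  move=> iz; rewrite !mxE (zerosP _ _ (fintype.subsetP zy1 _ iz)).
  by rewrite (zerosP _ _ (fintype.subsetP zy2 _ iz)) !subr0.
move=> /(_ lz); rewrite oppr_ge0 => s0; apply/fintype.subsetP => i ix; apply/zerosP.
move: s0; rewrite (bigD1 i) //=.
have := @sumr_ge0 R _ (index_enum 'I_n) (fun j => (j \in zeros x) && (j != i))
  (fun j => y1 0 j + y2 0 j) (fun j _ => addr_ge0 (y10 j) (y20 j)).
have := y10 i; have := y20 i; lra.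
Qed.

(** [w] refines the sum by [refinesD], and the sum refines the multiple of [w] by [refines_addl]. *)
Lemma cell_perturb w w' e D : 0 < e -> refines w w' ->
  cell (w' + e *: w) D <-> cell w D.
Proof.
move=> e0 r; have rw : refines w (e *: w) := refinesZ (ltW e0) (@refines_refl w).
have r1 := refinesD r rw.
have r2 : refines (w' + e *: w) w.
  rewrite -[X in refines _ X](scalerK (lt0r_neq0 e0)); apply: refinesZ.
    by rewrite invr_ge0 ltW.
  by rewrite addrC; apply: (refines_addl rw r).
by split; apply: refines_cell.
Qed.

(** Only finitely many collections of cells occur. Adding up one representative of each gives an
    element of [E] that refines all the others, by [refines_addl]. *)
Lemma refines_subcone w (E : set 'rV[R]_n) :
  E 0 -> (forall x y, E x -> E y -> E (x + y)) ->
  (forall x, E x -> refines w x) -> (forall x y, E x -> refines x y -> E y) ->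
  exists2 x, E x & E = [set y | refines x y].
Proof.
move=> E0 ED Er Ec.
(* [u T] represents the collection [T]; collections not occurring in [E] get 0, which lies in
   [E]. *)
have /choice[u uP] (T : {set {set 'I_n}}) : exists u, E u /\
    ((exists2 y, E y & T = [set D | `[< cell y D >]]%SET) ->
      T = [set D | `[< cell u D >]]%SET).
  have [[y Ey TE]|] := pselect (exists2 y, E y & T = [set D | `[< cell y D >]]%SET).
    by exists y.
  by exists 0.
have Es (P : pred {set {set 'I_n}}) : E (\sum_(T | P T) u T).
  by apply: big_ind => // T _; case: (uP T).
exists (\sum_T u T); first exact: Es xpredT.
apply/seteqP; split=> y /=; last exact/Ec/(Es xpredT).
move=> Ey; pose T := [set D | `[< cell y D >]]%SET.
have [_ /(_ (ex_intro2 _ _ y Ey erefl)) TE] := uP T.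
have cE D : cell y D <-> cell (u T) D.
  move/setP/(_ D): TE; rewrite !inE => TE.
  by split=> /asboolP; [rewrite TE|rewrite -TE] => /asboolP.
rewrite (bigD1 T) //=.
apply: (@refines_trans _ (u T)); last by apply: cell_refines => D /cE.
by apply: (@refines_addl w); apply: Er => //; apply: (uP T).1.
Qed.

End Refinement.

(** * The secondary fan *)

Section PolyhedralCone.
Variables (R : realType) (n : nat).
Implicit Types (C : set 'rV[R]_n).

Lemma polyhedral_coneP C : polyhedral C -> polyhedral_cone C.
Proof.
move=> [J [F [Fl ->]]].
exists #|J|, (\matrix_(i, j) F (enum_val j) (delta_mx 0 i)).
have FE j x : F j x = \sum_i x 0 i * F j (delta_mx 0 i).
  rewrite {1}[x]row_sum_delta; elim/big_rec2: _ => [|i y z _ <-].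
    exact: scalar0.
  by rewrite Fl.
apply/seteqP; split=> x /= xC j.
  rewrite mxE; under eq_bigr do rewrite mxE; by rewrite -FE.
have := xC (enum_rank j); rewrite mxE.
by under eq_bigr do rewrite mxE enum_rankK; rewrite -FE.
Qed.

Lemma closed_polyhedral_cone C : polyhedral_cone C -> closed C.
Proof.
move=> [m [M ->]].
have -> : [set x : 'rV[R]_n | forall j, 0 <= (x *m M) 0 j] =
    \bigcap_(j in setT) ((fun x : 'rV[R]_n => (x *m M) 0 j) @^-1` [set t | 0 <= t]).
  by apply/seteqP; split=> x xC j; [move=> _|]; apply: xC.
apply: closed_bigI => j _; apply: closed_comp => [x _|]; last exact: closed_ge.
have -> : (fun y : 'rV[R]_n => (y *m M) 0 j) = (fun y => \sum_i y 0 i * M i j).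
  by apply/funext => y; rewrite mxE.
apply: continuous_big => [|i _ y]; first exact: add_continuous.
by apply: continuousM; [exact: coord_continuous|exact: cst_continuous].
Qed.

End PolyhedralCone.

Section SecondaryFan.
Variables (R : realType) (K : fieldType) (n : nat) (I : ideal {mpoly K[n]}).
Implicit Types (w : 'rV[R]_n) (D : {set 'I_n}).
Local Notation L := (lineality R I).
Local Notation A := (config_of R I).

(** Reflexivity of finite-dimensional spaces. The configuration lives in the dual of [L], so the
    functionals defining its cells are evaluations at vectors of [L]. *)
Lemma dual_evaluation (U : vectType R) (f : 'Hom('Hom(U, R^o), R^o)) :
  exists u, forall g, f g = g u.
Proof.
pose b := vbasis (fullv : {vspace U}).
pose c (i : 'I_(\dim (fullv : {vspace U}))) : 'Hom(U, R^o) := linfun (coord b i : U -> R^o).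
exists (\sum_(i < \dim fullv) f (c i) *: b`_i) => g.
have -> : g = \sum_(i < \dim fullv) g b`_i *: c i.
  apply/lfunP => v; rewrite sum_lfunE {1}(coord_vbasis (memvf v)) linear_sum.
  apply: eq_bigr => i _; rewrite linearZ /= scale_lfunE lfunE /=.
  exact: mulrC.
rewrite !linear_sum /=; apply: eq_bigr => i _; rewrite !linearZ /=.
rewrite sum_lfunE (bigD1 i) //= big1 ?addr0 => [|j ji].
  rewrite scale_lfunE lfunE /= coord_free ?(basis_free (vbasisP _)) // eqxx.
  by rewrite [_ *: 1]mulr1 [LHS]mulrC.
rewrite scale_lfunE lfunE /= coord_free ?(basis_free (vbasisP _)) //.
by rewrite eq_sym (negbTE ji) scaler0.
Qed.

Lemma min_face_config w D : subd A w D <->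
  exists2 l, l \in L &
    D = [set i | [forall j, l 0 i + w 0 i <= l 0 j + w 0 j]]%SET.
Proof.
split=> [[f _ <-]|[l lL ->]].
  have [u fu] := dual_evaluation f; exists (vsval u); first exact: subvsP.
  apply/setP => i; rewrite !inE; apply: eq_forallb => j.
  by rewrite !fu !config_ofE.
pose u : subvs_of L := Subvs lL.
have ul : linear (fun g : 'Hom(subvs_of L, R^o) => g u).
  by move=> a g h; rewrite add_lfunE scale_lfunE.
pose F : {linear 'Hom(subvs_of L, R^o) -> R^o} :=
  HB.pack (fun g : 'Hom(subvs_of L, R^o) => g u) (GRing.isLinear.Build _ _ _ _ _ ul).
exists (linfun F) => //.
by apply/setP => i; rewrite !inE; apply: eq_forallb => j; rewrite !lfunE /= !config_ofE.
Qed.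

Hypotheses (i0 : 'I_n) (L1 : const_mx 1 \in L).

Lemma subd_cell w D : subd A w D <-> D != finset.set0 /\ cell L w D.
Proof.
rewrite min_face_config; split=> [[l lL ->]|[/set0Pn[i iD] [x [x0 xw xD]]]].
  have [i _ imin] := @arg_minP _ R 'I_n i0 xpredT (fun i => l 0 i + w 0 i) isT.
  split.
    by apply/set0Pn; exists i; rewrite inE; apply/forallP => j; apply: imin.
  (* Subtracting the minimum, a constant vector of [L], turns the minimizers into zeros. *)
  exists (l + w - (l 0 i + w 0 i) *: const_mx 1); split.
  - by move=> j; rewrite !mxE mulr1 subr_ge0 imin.
  - by rewrite addrAC addrK memvB // memvZ.
  apply/setP => j; rewrite !inE !mxE mulr1 subr_eq0.
  apply/eqP/forallP => [-> k|/(_ i) H]; first exact: imin.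
  by apply/eqP; rewrite eq_le H imin.
exists (x - w) => //; rewrite -xD; apply/setP => j; rewrite !inE.
rewrite -xD in iD; have /zerosP xi := iD.
apply/eqP/forallP => [xj k|/(_ i)]; rewrite !mxE !subrK; first by rewrite xj.
by rewrite xi => xj; apply/eqP; rewrite eq_le xj x0.
Qed.

Lemma eq_subd_refines w w' : subd A w = subd A w' -> refines L w w'.
Proof.
move=> ww' x x0 xw; have [x_0|xn0] := eqVneq (zeros x) finset.set0.
  by have [y y0 yw'] := nonneg_shift L1 w'; exists y; rewrite x_0 finset.sub0set.
have : subd A w (zeros x) by apply/subd_cell; split=> //; exists x.
by rewrite ww' => /subd_cell[_ [y [y0 yw' yx]]]; exists y; rewrite yx.
Qed.

(** The right side is closed, being polyhedral. Conversely [x + e *: w] induces the subdivision of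
    [w] and tends to [x]. *)
Lemma secondary_coneE w : secondary_cone A (subd A w) = [set x | refines L w x].
Proof.
apply/seteqP; split=> x.
  have cl := closed_polyhedral_cone (polyhedral_coneP (polyhedral_refines L w)).
  rewrite ((closure_id _).1 cl); apply: closureS => y /= yw.
  by apply: eq_subd_refines.
move=> /= wx B /nbhs_ballP[d /= d0 dB].
pose e := d / (1 + `|w|).
have w0 : 0 < 1 + `|w| by rewrite ltr_wpDr.
have e0 : 0 < e by rewrite divr_gt0.
exists (x + e *: w); split.
  apply/seteqP; split=> D /subd_cell[D0 cD]; apply/subd_cell; split=> //.
    by apply/(cell_perturb L1 D e0 wx).
  by apply/(cell_perturb L1 D e0 wx).
apply: dB; rewrite -ball_normE /= opprD addNKr normrN normrZ gtr0_norm //.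
by rewrite /e mulrAC ltr_pdivrMr // ltr_pM2l // ltrDr.
Qed.

Local Notation N w := [set x | refines L w x].

(** The supporting functional is the sum [G] of the inequalities of [N w] that are tight at [w']. *)
Lemma refines_face w w' : refines L w w' -> face (N w) (N w').
Proof.
move=> ww'; have [J [F [Fl NE]]] := polyhedral_refines L w.
have NP x : refines L w x <-> forall j, 0 <= F j x.
  have -> : refines L w x <-> N w x by [].
  by rewrite NE.
pose G x := \sum_(j | F j w' == 0) F j x.
have Gl : scalar G.
  move=> a x y; rewrite /G mulr_sumr -big_split /=.
  by apply: eq_bigr => j _; rewrite Fl.
exists (\col_i G (delta_mx 0 i)).
have GE x : (x *m \col_i G (delta_mx 0 i)) 0 0 = G x.
  rewrite mxE {2}[x]row_sum_delta.
  elim/big_rec2: _ => [|i y z _ ->]; first by rewrite (scalar0 Gl).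
  by rewrite mxE Gl.
split=> [x /NP xw|]; first by rewrite GE sumr_ge0.
apply/seteqP; split=> x /=.
  move=> w'x; have wx := refines_trans ww' w'x; split=> //; rewrite GE.
  (* Since w' - e x lies in [N w], a functional vanishing at [w'] is nonpositive at [x]. *)
  have [e e0 /(refines_trans ww')/NP ext] := refines_extend w'x.
  apply: big1 => j /eqP Fj; apply/eqP; rewrite eq_le (NP x).1 // andbT.
  have := ext j; rewrite -scaleNr scalarDZ // Fj add0r mulNr oppr_ge0.
  by rewrite pmulr_rle0.
move=> [/NP wx]; rewrite GE => /eqP; rewrite psumr_eq0 // => /allP Gx.
(* All inequalities tight at [w'] are tight at [x], so [w'] splits into [e *: x] and a rest inside
   [N w], and [refines_addl] applies. *)
have [j|j Fj|e e0 He] := @eps_small R J (fun j => F j w') (fun j => - F j x).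
- exact: (NP w').1.
- by have := Gx j (mem_index_enum j); rewrite Fj eqxx /= => /eqP ->; rewrite oppr0.
have wex : refines L w (w' - e *: x).
  by apply/NP => j; rewrite -scaleNr scalarDZ // mulNr -mulrN; case: (He j).
have rex : refines L w (e *: x) by apply: refinesZ (ltW e0) _; apply/NP.
have := refinesZ _ (refines_addl L1 rex wex).
move=> /(_ e^-1); rewrite invr_ge0 (ltW e0) scalerK ?gt_eqF // addrC subrK.
exact.
Qed.

Lemma secondary_subfan (Om : set 'rV[R]_n) :
  (forall w w', Om w -> refines L w w' -> Om w') ->
  exists G, subfan (secondary_fan A) G /\ Om = fan_support G.
Proof.
move=> OmP; exists [set N w | w in Om]; split; last first.
  apply/seteqP; split=> [w Omw|w [_ [w' Omw' <-]]]; last exact: OmP.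
  by exists (N w); [exists w|exact: refines_refl].
split=> [_ [w _ <-]|].
  by exists (subd A w); [exists w|exact: secondary_coneE].
(* Faces and intersections are both subsets of this kind, hence cones of a single vector, which lies
   in [Om] by closure under coarsening. *)
have subcone w (E : set 'rV[R]_n) : Om w -> E 0 ->
    (forall x y, E x -> E y -> E (x + y)) -> E `<=` N w ->
    (forall x y, E x -> refines L x y -> E y) ->
    exists w', [/\ Om w', refines L w w' & E = N w'].
  move=> Omw E0 ED Ew Ec; have [w' Ew' ->] := refines_subcone L1 E0 ED Ew Ec.
  by exists w'; split=> //; [apply: (OmP w); last exact: Ew|exact: Ew].
split.
- pose f (T : {set {set 'I_n}}) := secondary_cone A [set` T].
  apply: (@sub_finite_set _ _ (range f)); last exact: finite_image.
  move=> _ [w _ <-]; exists [set D | `[< subd A w D >]]%SET => //.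
  rewrite /f -secondary_coneE; congr (secondary_cone A _).
  by apply/seteqP; split=> D /=; rewrite inE => /asboolP.
- move=> _ [w _ <-]; exact/polyhedral_coneP/polyhedral_refines.
- move=> _ D [w Omw <-] [l [l0 ->]].
  case: (@subcone w (N w `&` [set x | (x *m l) 0 0 = 0])) => //.
  + by split; [exact: refines0|rewrite /= mul0mx mxE].
  + move=> x y [/= wx lx] [wy ly]; split; first exact: refinesD.
    by rewrite /= mulmxDl mxE lx ly addr0.
  + move=> x y [/= wx lx] xy; split=> /=; first exact: refines_trans xy.
    (* The functional [l] is nonnegative at x - e y and zero at [x], hence nonpositive at [y]. *)
    have [e e0 /(refines_trans wx) /l0] := refines_extend xy.
    rewrite -scaleNr mulmxDl -scalemxAl mxE lx add0r mxE mulNr oppr_ge0.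
    rewrite pmulr_rle0 // => ly; apply/eqP; rewrite eq_le ly l0 //.
    exact: refines_trans xy.
  by move=> w' [Omw' _ ->]; exists w'.
- move=> _ _ [w Omw <-] [w' Omw' <-].
  case: (@subcone w (N w `&` N w')) => //.
  + by split; exact: refines0.
  + by move=> x y [wx w'x] [wy w'y]; split; exact: refinesD.
  + by move=> x y [wx w'x] xy; split; [exact: refines_trans xy|exact: refines_trans xy].
  move=> u [_ wu NE]; rewrite NE; split; apply: refines_face => //.
  suff [] : (N w `&` N w') u by [].
  by rewrite NE; exact: refines_refl.
Qed.

End SecondaryFan.

(** * Initial ideals *)

Section InitialIdeal.
Variables (R : realType) (K : fieldType) (n : nat).
Implicit Types (w v x : 'rV[R]_n) (m : 'X_{1..n}) (p q : {mpoly K[n]}).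
Implicit Types (I J : ideal {mpoly K[n]}) (D : {set 'I_n}).
Implicit Types (P Q : pred 'X_{1..n}).
Local Notation wt w c := (fun m => weight w m == c).
Local Notation below w c := (fun m => weight w m < c).

Lemma filt_filt P Q p : filt P (filt Q p) = filt (fun m => P m && Q m) p.
Proof.
by apply/mpolyP => m; rewrite !mcoeff_filt; case: (P m); case: (Q m).
Qed.

Lemma filtC P Q p : filt P (filt Q p) = filt Q (filt P p).
Proof. by rewrite !filt_filt; apply: eq_filt => m _; rewrite andbC. Qed.

Lemma filt0 P : filt P (0 : {mpoly K[n]}) = 0.
Proof. by rewrite /filt msupp0 big_nil. Qed.

Lemma filt_pred0 P p : (forall m, P m = false) -> filt P p = 0.
Proof. by move=> P0; apply/mpolyP => m; rewrite mcoeff_filt P0 mcoeff0. Qed.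

Lemma below_msupp w c p m : filt (below w c) p = 0 -> m \in msupp p ->
  c <= weight w m.
Proof.
move=> /mpolyP/(_ m); rewrite mcoeff_filt mcoeff0 mcoeff_msupp leNgt.
by case: ifP => // _ ->; rewrite eqxx.
Qed.

Lemma initial_formE w c p : filt (below w c) p = 0 -> filt (wt w c) p != 0 ->
  initial_form w p = filt (wt w c) p.
Proof.
move=> /below_msupp cp pc0; have [m0 m0p] : exists2 m0, m0 \in msupp p & weight w m0 = c.
  apply: contrapT => noc; case/eqP: pc0; apply/mpolyP => m.
  rewrite mcoeff_filt mcoeff0; case: eqP => // wm.
  by apply: memN_msupp_eq0; apply/negP => mp; apply: noc; exists m.
move=> wm0; apply: eq_filt => m mp; apply/allP/eqP => [mmin|-> m' /cp//].
by apply/eqP; rewrite eq_le (cp _ mp) -wm0 mmin.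
Qed.

Lemma initial_weight w p : exists2 c, filt (below w c) p = 0 &
  initial_form w p = filt (wt w c) p.
Proof.
have [->|p0] := eqVneq p 0.
  by exists 0; rewrite filt0 // /initial_form msupp0 big_nil.
have s0 : (0 < size (msupp p))%N by rewrite lt0n size_eq0 msupp_eq0.
pose f (i : 'I_(size (msupp p))) := weight w (nth 0%MM (msupp p) i).
have [i _ imin] := @arg_minP _ R _ (Ordinal s0) xpredT f isT.
have bp : filt (below w (f i)) p = 0.
  apply/mpolyP => m; rewrite mcoeff_filt mcoeff0; case: ifP => // wm.
  apply: memN_msupp_eq0; apply/negP => mp.
  have mi : (index m (msupp p) < size (msupp p))%N by rewrite index_mem.
  by have := imin (Ordinal mi) isT; rewrite /f /= nth_index // leNgt wm.
exists (f i) => //; apply: initial_formE => //.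
apply/eqP => /mpolyP/(_ (nth 0%MM (msupp p) i)); rewrite mcoeff_filt eqxx mcoeff0 => /eqP.
by apply/negP; rewrite -mcoeff_msupp mem_nth.
Qed.

Lemma graded_ideal_gen w (G : set {mpoly K[n]}) :
  (forall c p, G p -> ideal_set (ideal_gen G) (filt (wt w c) p)) ->
  graded w (ideal_gen G).
Proof.
move=> GG c q Gq.
pose J' := [set q | forall c, ideal_set (ideal_gen G) (filt (wt w c) q)].
suff: J' q by apply.
apply: Gq; split=> [|p Gp d]; last exact: GG.
have [J0 JD JM] := idealP (ideal_gen G).
split=> [d|p r Jp Jr d|a p Jp d]; first by rewrite filt0.
  by rewrite filtD; apply: JD.
rewrite (mpolyE a) mulr_suml; elim/big_rec: _ => [|m r _ Jr]; first by rewrite filt0.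
rewrite filtD; apply: JD => //.
rewrite -scalerAl filtZ filtMX -mul_mpolyC; apply: (JM); apply: (JM).
rewrite (@eq_filt _ _ _ (wt w (d - weight w m))) // => m' _.
by rewrite weightD addrC eq_sym -subr_eq eq_sym.
Qed.

(** The part of weight [c] may be zero, so the condition, unlike being an initial form, is stable
    under sums and multiples and defines an ideal. *)
Lemma initial_idealP w J q : ideal_set (initial_ideal w J) q <->
  forall c, exists p, [/\ ideal_set J p, filt (below w c) p = 0
    & filt (wt w c) p = filt (wt w c) q].
Proof.
have [J0 JD JM] := idealP J.
split=> [Iq|Iq].
  pose J' := [set q | forall c, exists p, [/\ ideal_set J p,
    filt (below w c) p = 0 & filt (wt w c) p = filt (wt w c) q]].
  suff: J' q by apply.
  apply: Iq; split; last first.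
    move=> _ [p Jp <-] c; have [e pe ->] := initial_weight w p.
    have [->|ce] := eqVneq c e.
      by exists p; split=> //; rewrite filt_filt; apply: eq_filt => m _; rewrite andbb.
    exists 0; rewrite !filt0; split=> //.
    rewrite filt_filt filt_pred0 // => m; apply/negP => /andP[/eqP -> /eqP ec].
    by case/eqP: ce.
  split=> [c|p q1 Jp Jq c|a p Jp].
  - by exists 0; rewrite !filt0.
  - have [p' [Jp' bp ep]] := Jp c; have [q' [Jq' bq eq]] := Jq c.
    exists (p' + q'); rewrite !filtD bp bq ep eq addr0; split=> //; exact: JD.
  rewrite (mpolyE a) mulr_suml; elim/big_rec: _ => [|m r _ Jr] c.
    by exists 0; rewrite !filt0.
  have [r' [Jr' br er]] := Jr c; have [p' [Jp' bp ep]] := Jp (c - weight w m).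
  exists ((a@_m *: 'X_[m]) * p' + r'); split.
  - by apply: JD => //; apply: JM.
  - rewrite filtD br addr0 -scalerAl filtZ filtMX.
    rewrite (@eq_filt _ _ _ (below w (c - weight w m))) ?bp ?mulr0 ?scaler0 //.
    by move=> m' _; rewrite weightD addrC -ltrBrDr.
  rewrite !filtD er -!scalerAl !filtZ !filtMX.
  have E r1 : filt (fun m' => weight w (m + m')%MM == c) r1
      = filt (wt w (c - weight w m)) r1.
    by apply: eq_filt => m' _; rewrite weightD addrC eq_sym -subr_eq eq_sym.
  by rewrite !E ep.
rewrite -[q](filt_const true) (filt_split w q (fun _ _ => true)) filt_const.
apply: ideal_sum => c _; have [p [Jp bp <-]] := Iq c.
have [->|pc] := eqVneq (filt (wt w c) p) 0; first by case: (idealP (initial_ideal w J)).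
by rewrite -(initial_formE bp pc); apply: initial_in.
Qed.

Definition supported D m := [forall i, (i \in D) || (m i == 0%N)].

(** Turns [rho] into a selection of terms, which can be compared with weight components. *)
Lemma rhoE D p : rho D p = filt (supported D) p.
Proof.
rewrite /rho comp_mpolyEX /filt [RHS]big_mkcond /=; apply: eq_bigr => m _.
rewrite comp_mpolyX; case: ifP => [/forallP mD|/negbT].
  rewrite mpolyXE_id; congr (_ *: _); apply: eq_bigr => i _; rewrite tnth_mktuple.
  by have := mD i; case: (i \in D) => //= /eqP ->; rewrite !expr0.
case/forallPn => i; rewrite negb_or => /andP[iD mi].
rewrite (bigD1 i) //= tnth_mktuple (negbTE iD) expr0n (negbTE mi) mul0r.
by rewrite scaler0.
Qed.

Lemma weight_ge0 x m : nonneg x -> 0 <= weight x m.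
Proof. by move=> x0; apply: sumr_ge0 => i _; rewrite mulrn_wge0. Qed.

Lemma weight_eq0 x m : nonneg x -> (weight x m == 0) = supported (zeros x) m.
Proof.
move=> x0; rewrite psumr_eq0 => [|i _]; last by rewrite mulrn_wge0.
apply/allP/forallP => [H i|H i _]; last first.
  by have := H i; rewrite inE mulrn_eq0 orbC.
by have := H i (mem_index_enum i); rewrite inE mulrn_eq0 orbC.
Qed.

Lemma weightB v w m : weight (v - w) m = weight v m - weight w m.
Proof. by rewrite addrC -scaleN1r weight_lin mulN1r addrC. Qed.

(** The component of [p] of (x - w)-weight -c lies in [J]. Its terms have [w]-weight [c] plus their
    [x]-weight, so at least [c], with equality exactly for monomials in the variables of
    [zeros x]. *)
Lemma rho_initial_ideal w x J p : nonneg x -> graded (x - w) J ->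
  ideal_set J p -> ideal_set (initial_ideal w J) (rho (zeros x) p).
Proof.
move=> x0 gJ Jp; apply/initial_idealP => c.
exists (filt (wt (x - w) (- c)) p); split; first exact: gJ.
  rewrite filt_filt filt_pred0 // => m; apply/negP => /andP[wc].
  by rewrite weightB => /eqP; have := weight_ge0 m x0; lra.
rewrite rhoE !filt_filt; apply: eq_filt => m _; rewrite -weight_eq0 //.
case: eqP => //= wc; rewrite weightB wc -subr_eq0 opprK subrK //.
Qed.

Lemma rho_rho D D' p : D \subset D' -> rho D (rho D' p) = rho D p.
Proof.
move=> DD'; rewrite !rhoE filt_filt; apply: eq_filt => m _.
rewrite andb_idr // => /forallP mD; apply/forallP => i.
by have /orP[/(fintype.subsetP DD') ->|->] := mD i; rewrite ?orbT.
Qed.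

Lemma weight1 m : weight (const_mx 1 : 'rV[R]_n) m = (mdeg m)%:R.
Proof.
by rewrite mdegE natr_sum; apply: eq_bigr => i _; rewrite mxE.
Qed.

Lemma homogeneous_graded I : homogeneous_ideal I -> graded (const_mx 1 : 'rV[R]_n) I.
Proof.
move=> [G [Gh IG]] c p; rewrite IG; apply: graded_ideal_gen => d q Gq.
have [e qe] := Gh q Gq.
have -> : filt (wt (const_mx 1 : 'rV[R]_n) d) q = filt (fun=> e%:R == d) q.
  by apply: eq_filt => m mq; rewrite weight1 (elimT (dhomogP _ _ _) qe).
rewrite filt_const; case: ifP => _; first by move=> J [_]; apply.
by case: (idealP (ideal_gen G)).
Qed.

End InitialIdeal.

(** * Hilbert functions *)

Section Subspaces.
Variables (K : fieldType) (V : vectType K).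
Implicit Types (U W : {vspace V}).

(** A subspace of maximal dimension inside [S] is all of [S]. *)
Lemma vspace_of_set (S : set V) : S 0 ->
  (forall a u v, S u -> S v -> S (a *: u + v)) ->
  exists U, forall v, v \in U <-> S v.
Proof.
move=> S0 Sl.
pose P d := `[< exists U, (forall v, v \in U -> S v) /\ \dim U = d >].
have exP : exists d, P d.
  exists 0%N; apply/asboolP; exists 0%VS; rewrite dimv0; split=> // v.
  by rewrite memv0 => /eqP ->.
have leP d : P d -> (d <= \dim (fullv : {vspace V}))%N.
  by case/asboolP => U [_ <-]; apply/dimvS/subvf.
case: (ex_maxnP exP leP) => d /asboolP[U [US dU]] maxd.
exists U => v; split=> [|Sv]; first exact: US.
suff /subvP/(_ v) : (U + <[v]> <= U)%VS.
  by apply; apply: (subvP (addvSr U _)); apply: memv_line.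
rewrite -(geq_leqif (dimv_leqif_sup (addvSl U <[v]>%VS))) dU.
apply: maxd; apply/asboolP; exists (U + <[v]>)%VS; split=> // u.
by case/memv_addP => u1 /US Su1 [_ /vlineP[a ->] ->]; rewrite addrC; apply: Sl.
Qed.

(* Both dimensions are the sum over [k] of those of the images under [f k]. *)
Lemma dim_filtration U W (f : nat -> 'End(V)) N :
  let F k := (\bigcap_(i < k) lker (f i))%VS in
  F N = 0%VS ->
  (forall k, (k < N)%N -> (f k @: (U :&: F k) = f k @: (W :&: F k))%VS) ->
  \dim U = \dim W.
Proof.
move=> F FN fE.
have H k : (k <= N)%N -> \dim (U :&: F (N - k)%N) = \dim (W :&: F (N - k)%N).
  elim: k => [|k IH] kN; first by rewrite subn0 FN !capv0.
  have FS : F (N - k)%N = (F (N - k.+1)%N :&: lker (f (N - k.+1)%N))%VS.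
    by rewrite -(subnSK kN) /F big_ord_recr.
  have := IH (ltnW kN); rewrite FS !capvA.
  rewrite -(limg_ker_dim (f (N - k.+1)%N) (U :&: _)).
  rewrite -(limg_ker_dim (f (N - k.+1)%N) (W :&: _)) => ->.
  by rewrite fE // ltn_subrL (leq_ltn_trans _ kN).
by have := H N (leqnn N); rewrite subnn /F big_ord0 !capvf.
Qed.

End Subspaces.

Section Hilbert.
Variables (R : realType) (K : fieldType) (n : nat).
Implicit Types (w : 'rV[R]_n) (m : 'X_{1..n}) (p q : {mpoly K[n]}).
Implicit Types (I J : ideal {mpoly K[n]}) (d : nat).
Local Notation wt w c := (fun m => weight w m == c).
Local Notation below w c := (fun m => weight w m < c).
Local Notation coefs d := {ffun 'X_{1..n < d} -> K^o}.

(** Coefficient vectors give a finite-dimensional model of the polynomials of degree less than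
    [d]. *)
Definition poly_of d (v : coefs d) : {mpoly K[n]} :=
  \sum_(b : 'X_{1..n < d}) v b *: 'X_[b].

Definition coefs_of d p : coefs d := [ffun b => p@_(bmnm b)].

Lemma mcoeff_poly_of d (v : coefs d) (b : 'X_{1..n < d}) :
  (poly_of v)@_(bmnm b) = v b.
Proof.
rewrite /poly_of raddf_sum (bigD1 b) //= big1 ?addr0 => [|b' bb'].
  by rewrite mcoeffZ mcoeffX eqxx mulr1.
rewrite mcoeffZ mcoeffX; case: eqP => [e|]; last by rewrite mulr0.
by case/eqP: bb'; apply: val_inj.
Qed.

Lemma mcoeff_poly_of_ge d (v : coefs d) m : (d <= mdeg m)%N ->
  (poly_of v)@_m = 0.
Proof.
move=> dm; rewrite /poly_of raddf_sum big1 //= => b _.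
rewrite mcoeffZ mcoeffX; case: eqP => [e|]; last by rewrite mulr0.
by have := bmdeg b; rewrite e ltnNge dm.
Qed.

Lemma coefs_ofK d p : poly_of (coefs_of d p) = filt (fun m => mdeg m < d)%N p.
Proof.
apply/mpolyP => m; rewrite mcoeff_filt; case: ltnP => [md|]; last exact: mcoeff_poly_of_ge.
by rewrite -[m]/(bmnm (BMultinom md)) mcoeff_poly_of ffunE.
Qed.

Lemma poly_of_linear d : linear (@poly_of d).
Proof.
move=> a u v; rewrite /poly_of scaler_sumr -big_split /=.
by apply: eq_bigr => b _; rewrite !ffunE scalerDl scalerA.
Qed.

Lemma ideal_subspace J d :
  exists U : {vspace coefs d}, forall v, v \in U <-> ideal_set J (poly_of v).
Proof.
have [J0 JD JM] := idealP J; apply: vspace_of_set.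
  by rewrite /poly_of big1 // => b _; rewrite ffunE scale0r.
move=> a u v Ju Jv; rewrite poly_of_linear; apply: JD => //.
by rewrite -mul_mpolyC; apply: JM.
Qed.

Definition ideal_trunc J d : {vspace coefs d} := sval (cid (ideal_subspace J d)).

Lemma ideal_truncP J d v : v \in ideal_trunc J d <-> ideal_set J (poly_of v).
Proof. exact: (svalP (cid (ideal_subspace J d))). Qed.

(* Cumulative: it counts all degrees less than [d]. *)
Definition hilbert J d := \dim (ideal_trunc J d).

Lemma ideal_trunc_sub J J' d : ideal_set J `<=` J' ->
  (ideal_trunc J d <= ideal_trunc J' d)%VS.
Proof. by move=> JJ'; apply/subvP => v /ideal_truncP/JJ'/ideal_truncP. Qed.

Lemma hilbert_eq J J' : ideal_set J `<=` J' ->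
  (forall d, (hilbert J' d <= hilbert J d)%N) -> ideal_set J' `<=` J.
Proof.
move=> JJ' h p Jp; pose d := msize p.
have pE : poly_of (coefs_of d p) = p.
  rewrite coefs_ofK -[RHS](filt_const true); apply: eq_filt => m.
  exact: msize_mdeg_lt.
have /subvP J'J : (ideal_trunc J' d <= ideal_trunc J d)%VS.
  by rewrite -(geq_leqif (dimv_leqif_sup (ideal_trunc_sub d JJ'))); apply: h.
by rewrite -pE; apply/ideal_truncP/J'J/ideal_truncP; rewrite pE.
Qed.

Definition coefs_filt d (P : pred 'X_{1..n}) (v : coefs d) : coefs d :=
  [ffun b => if P (bmnm b) then v b else 0].

Lemma coefs_filt_linear d P : linear (@coefs_filt d P).
Proof.
move=> a u v; apply/ffunP => b; rewrite !ffunE; case: ifP => //.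
by rewrite scaler0 addr0.
Qed.
HB.instance Definition _ d P :=
  GRing.isLinear.Build K (coefs d) (coefs d) _ (@coefs_filt d P) (@coefs_filt_linear d P).

Lemma poly_of_filt d P (v : coefs d) : poly_of (coefs_filt P v) = filt P (poly_of v).
Proof.
apply/mpolyP => m; rewrite mcoeff_filt.
have [md|md] := ltnP (mdeg m) d; last by rewrite !mcoeff_poly_of_ge // if_same.
by rewrite -[m]/(bmnm (BMultinom md)) !mcoeff_poly_of ffunE.
Qed.

Lemma graded_trunc J d p : graded (const_mx 1 : 'rV[R]_n) J ->
  ideal_set J p -> ideal_set J (filt (fun m => mdeg m < d)%N p).
Proof.
move=> gJ Jp; have := graded_pred (fun r => r < d%:R) gJ Jp.
by congr ideal_set; apply: eq_filt => m _; rewrite /= weight1 ltr_nat.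
Qed.

(** The truncations are filtered by vanishing of the components of lowest weights. At each step [J]
    and its initial ideal have the same next components, by [initial_idealP]. *)
Lemma hilbert_initial w J d : graded (const_mx 1 : 'rV[R]_n) J ->
  hilbert (initial_ideal w J) d = hilbert J d.
Proof.
move=> gJ.
pose s := sort <=%R (undup [seq weight w (bmnm b) | b : 'X_{1..n < d}]).
have s_uniq : uniq s by rewrite sort_uniq undup_uniq.
have s_sorted : sorted <=%R s := sort_sorted le_total _.
have sP (b : 'X_{1..n < d}) : weight w (bmnm b) \in s.
  by rewrite mem_sort mem_undup; apply/mapP; exists b; rewrite ?mem_enum.
pose f k : 'End(coefs d) := linfun (coefs_filt (wt w s`_k)).
have FP k v : (k <= size s)%N -> v \in (\bigcap_(i < k) lker (f i))%VS <->
    forall b, weight w (bmnm b) \in take k s -> v b = 0.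
  move=> ks; rewrite memvE; split.
    move=> /subv_bigcapP vF b /(nthP 0)[j]; rewrite size_takel // => jk.
    rewrite nth_take // => wb; have := vF (Ordinal jk) isT.
    rewrite -memvE memv_ker lfunE /= => /eqP/ffunP/(_ b).
    by rewrite !ffunE wb eqxx.
  move=> v0; apply/subv_bigcapP => i _; rewrite -memvE memv_ker lfunE /=.
  apply/eqP/ffunP => b; rewrite !ffunE; case: eqP => // wb; apply: v0.
  by rewrite wb -(nth_take 0 (ltn_ord i)) mem_nth // size_takel.
have takeP k x : (k < size s)%N -> x \in s -> (x \in take k s) = (x < s`_k).
  move=> ks xs; rewrite in_take // -{2}(nth_index 0 xs).
  rewrite (lt_sorted_ltn_nth 0) ?inE ?index_mem //.
  by rewrite lt_sorted_uniq_le s_uniq.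
have FB k v : (k < size s)%N -> v \in (\bigcap_(i < k) lker (f i))%VS <->
    filt (below w s`_k) (poly_of v) = 0.
  move=> ks; rewrite FP ?(ltnW ks) //; split=> [v0|].
    apply/mpolyP => m; rewrite mcoeff_filt mcoeff0; case: ifP => // wm.
    have [md|md] := ltnP (mdeg m) d; last exact: mcoeff_poly_of_ge.
    by rewrite -[m]/(bmnm (BMultinom md)) mcoeff_poly_of v0 // takeP.
  move=> /mpolyP v0 b; rewrite takeP ?sP // => wb.
  by have := v0 (bmnm b); rewrite mcoeff_filt wb mcoeff_poly_of mcoeff0.
apply: (@dim_filtration _ _ _ _ f (size s)).
  apply/eqP; rewrite -subv0; apply/subvP => v /FP v0.
  by rewrite memv0; apply/eqP/ffunP => b; rewrite v0 ?take_size // ffunE.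
move=> k ks; apply/vspaceP => u; apply/memv_imgP/memv_imgP => -[v].
  rewrite memv_cap => /andP[/ideal_truncP/initial_idealP/(_ s`_k)[p [Jp bp ep]]].
  (* [p] may have terms of degree at least [d]; the grading by degree lets them be cut off inside
     [J]. *)
  move=> /(FB _ _ ks) vb ->; exists (coefs_of d p).
    rewrite memv_cap; apply/andP; split.
      by apply/ideal_truncP; rewrite coefs_ofK; apply: graded_trunc.
    by apply/FB => //; rewrite coefs_ofK filtC bp filt0.
  apply/ffunP => b; rewrite !lfunE !ffunE; have /mpolyP/(_ (bmnm b)) := ep.
  rewrite !mcoeff_filt mcoeff_poly_of; exact: esym.
rewrite memv_cap => /andP[/ideal_truncP Jv /(FB _ _ ks) vb ->].
have ffE : coefs_filt (wt w s`_k) (coefs_filt (wt w s`_k) v) = coefs_filt (wt w s`_k) v.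
  by apply/ffunP => b; rewrite !ffunE; case: eqP.
exists (coefs_filt (wt w s`_k) v); last by rewrite !lfunE /= ffE.
rewrite memv_cap; apply/andP; split.
  apply/ideal_truncP/initial_idealP => c; rewrite poly_of_filt.
  have [->|cs] := eqVneq c s`_k.
    by exists (poly_of v); split=> //; rewrite -!poly_of_filt ffE.
  exists 0; rewrite !filt0; split=> //; first by case: (idealP J).
  rewrite filt_filt filt_pred0 // => m; apply/negP => /andP[/eqP -> /eqP ec].
  by case/eqP: cs.
by apply/FB => //; rewrite poly_of_filt filtC vb filt0.
Qed.

End Hilbert.

(** * Cellular ideals, and closure of [Omega I] under coarsening *)

Section Cellular.
Variables (R : realType) (K : fieldType) (n : nat) (I : ideal {mpoly K[n]}).
Implicit Types (w : 'rV[R]_n).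
Local Notation L := (lineality R I).
Hypotheses (i0 : 'I_n) (I_graded : graded (const_mx 1 : 'rV[R]_n) I).

Lemma lineality_const : const_mx 1 \in L.
Proof. exact/linealityP/gradedP. Qed.

Lemma cellular_graded w l : l \in L -> graded l (cellular_ideal I w).
Proof.
move=> /linealityP/gradedP gl; apply: graded_ideal_gen => c _ [D Dw [p Ip <-]].
move=> J [_]; apply; exists D => //; exists (filt (fun m => weight l m == c) p).
  exact: gl.
by rewrite !rhoE filtC.
Qed.

Lemma cellular_sub_initial w :
  ideal_set (cellular_ideal I w) `<=` initial_ideal w I.
Proof.
apply: smallest_sub; first exact: idealP.
move=> _ [D /(subd_cell i0 lineality_const)[_ [x [x0 xw <-]]] [p Ip <-]].
by apply: rho_initial_ideal => //; apply/gradedP/linealityP.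
Qed.

(* A cell of the finer subdivision is contained in a cell [D'] of the coarser
   one, and restriction to it factors through restriction to [D']. *)
Lemma cellular_sub_initial_cellular w w' : refines L w w' ->
  ideal_set (cellular_ideal I w) `<=` initial_ideal w (cellular_ideal I w').
Proof.
move=> ww'; apply: smallest_sub; first exact: idealP.
move=> _ [D /(subd_cell i0 lineality_const)[D0 [x [x0 xw xD]]] [p Ip <-]].
have [y [y0 yw' xy]] := ww' x x0 xw; rewrite xD in xy.
rewrite -(rho_rho p xy) -xD; apply: rho_initial_ideal => //.
  exact: cellular_graded.
move=> J [_]; apply; exists (zeros y); last by exists p.
apply/(subd_cell i0 lineality_const); split; last by exists y.
by apply: contraNneq D0 => y_0; rewrite -finset.subset0 -y_0.
Qed.

Lemma Omega_refines w w' : Omega I w -> refines L w w' -> Omega I w'.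
Proof.
move=> Ow ww'; apply/seteqP; split; first exact: cellular_sub_initial.
apply: (hilbert_eq (@cellular_sub_initial w')) => d.
(* Both sides become Hilbert functions of initial ideals for [w]: that of [I], which is [I_w] by
   assumption, and that of [I_w']. *)
rewrite (hilbert_initial _ _ I_graded) -(hilbert_initial w _ I_graded).
rewrite -(hilbert_initial w d (@cellular_graded w' _ lineality_const)).
apply/dimvS/ideal_trunc_sub; rewrite -Ow.
exact: cellular_sub_initial_cellular.
Qed.

End Cellular.

Theorem theorem5p3 (R : realType) (n : nat) (I : ideal {mpoly R[i][n]})
  (I_homog : homogeneous_ideal I)
  (I_irr : ~ (irrelevant_ideal R[i] n `<=` I)) :
  exists G : set (set 'rV[R]_n),
    subfan (secondary_fan (config_of R I)) G /\
    Omega I = fan_support G.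
Proof.
have gI := @homogeneous_graded R _ _ _ I_homog.
(* Without variables the irrelevant ideal would have no generators and lie in [I]. *)
have [i0 _] : exists i : 'I_n, True.
  apply: contrapT => no_i; apply: I_irr; apply: smallest_sub; first exact: idealP.
  by move=> p [j _ _]; case: no_i; exists j.
apply: (secondary_subfan i0 (lineality_const gI)) => w w'.
exact: Omega_refines.
Qed.
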